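(* Let $f$ be a value-monotone allocation rule. Suppose that for each bidder $i$ with true type $\theta_i=(v_i,r_i)$ and each profile $\theta_{-i}$ of the other bidders there are winning and losing payment functions of the form $$\tilde p_i(r_i')=\tilde g(r_i')+h(\theta_{-i}),\qquad \bar p_i(r_i')=\bar g(r_i')+h(\theta_{-i})\qquad (r_i'\subseteq r_i)$$ such that $$\tilde g(r_i)-\bar g(r_i)=v_i^\ast(r_i),\qquad r_i\in\arg\min_{r_i'\subseteq r_i}\tilde g(r_i'),\qquad r_i\in\arg\min_{r_i'\subseteq r_i}\bar g(r_i').$$ Then $f$ is network-implementable.
   Context: Network auction model. There is a finite set $N$ of bidders and a seller. Bidder $i$ has true type $\theta_i=(v_i,r_i)$, where $v_i\in\mathbb R_{\ge0}$ is her value for winning and $r_i$ is her set of neighbors in the social network. She reports $\theta_i'=(v_i',r_i')\in\Theta_i=\mathbb R_{\ge 0}\times\mathcal P(r_i)$, where $\mathcal P(r_i)$ is the power set of $r_i$; $\Theta=\times_i\Theta_i$. A mechanism is $\mathcal M=(f,p)$ with $f_i:\Theta\to\{0,1\}$ and $p_i:\Theta\to\mathbb R$; utility is $u_i(\theta')=f_i(\theta')v_i-p_i(\theta')$. $\mathcal M$ is strategyproof if $u_i((v_i,r_i),\theta'_{-i})\ge u_i((v_i',r_i'),\theta'_{-i})$ for all $i$, all true types $(v_i,r_i)$, all $(v_i',r_i')\in\Theta_i$ and all $\theta'_{-i}$. $f$ is network-implementable if there is a payment rule $p$ such that $(f,p)$ is strategyproof. $f$ is value-monotone if $f_i((v_i',r_i'),\theta_{-i}')=1$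 implies $f_i((v_i'',r_i'),\theta_{-i}')=1$ for all $v_i''\ge v_i'$. With $\theta_{-i}$ fixed, the critical winning bid is $v_i^\ast(r_i')=\inf\{x\in\mathbb R_{\ge0}: f_i((x,r_i'),\theta_{-i})=1\}$. The payment rule with winning payment $\tilde p_i$ and losing payment $\bar p_i$ is $p_i=f_i\tilde p_i+(1-f_i)\bar p_i$. The functions $\tilde g,\bar g$ may depend on $i$ and $\theta_{-i}$, but not on the bid $v_i$. *)

(* Defs.v *)
From HB Require Import structures.
From mathcomp Require Import all_boot all_order all_algebra.
From mathcomp Require Import all_classical all_reals ereal.

Set Implicit Arguments.
Unset Strict Implicit.
Unset Printing Implicit Defensive.

Import Order.TTheory GRing.Theory Num.Theory.
Local Open Scope classical_set_scope.
Local Open Scope ring_scope.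

(* The nodes of the social network are the bidders and the seller ([None]);
   the neighbors of bidder i are nodes other than i. *)
Definition nbhd (N : finType) (i : N) : Type :=
  {set {x : option N | x != Some i}}.

Section Auction.
Variables (R : realType) (N : finType).

Definition bidder_type (i : N) : Type := ({nonneg R} * nbhd i)%type.

Definition profile : Type := forall i : N, bidder_type i.

(* Profiles theta_{-i} of all the bidders but i. *)
Definition others (i : N) : Type :=
  forall j : {j : N | j != i}, bidder_type (val j).

(* The profile (theta_i, theta_{-i}). *)
Definition join (i : N) (t : bidder_type i) (o : others i) : profile :=
  fun j => match eqVneq j i with
           | EqNotNeq e => ecast k (bidder_type k) (esym e) t
           | NeqNotEq ne => o (Sub j ne)
           end.

Definition allocation : Type := forall i : N, profile -> bool.

Definition payment : Type := forall i : N, profile -> R.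

Definition utility (f : allocation) (p : payment) (i : N) (v : {nonneg R})
    (theta' : profile) : R :=
  (f i theta')%:R * v%:num - p i theta'.

(* The reports Theta_i available to a bidder of true type t. *)
Definition reports (i : N) (t : bidder_type i) : set (bidder_type i) :=
  [set t' : bidder_type i | t'.2 \subset t.2].

(* The true type t = (v_i, r_i) is universally quantified, so f and p are
   defined on all profiles and cannot depend on the true types. *)
Definition strategyproof (f : allocation) (p : payment) : Prop :=
  forall (i : N) (t t' : bidder_type i) (o : others i),
    reports t t' ->
    utility f p i t.1 (join t o) >= utility f p i t.1 (join t' o).

Definition network_implementable (f : allocation) : Prop :=
  exists p : payment, strategyproof f p.

Definition value_monotone (f : allocation) : Prop :=
  forall (i : N) (v' v'' : {nonneg R}) (r' : nbhd i) (o : others i),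
    f i (join (v', r') o) -> v'%:num <= v''%:num -> f i (join (v'', r') o).

(* The infimum is taken in the extended reals: it is +oo when the bidder
   cannot win by reporting r' (whereas [inf set0 = 0] in [R]). *)
Definition critical_bid (f : allocation) (i : N) (o : others i) (r' : nbhd i)
    : \bar R :=
  ereal_inf [set x%:num%:E | x in [set x : {nonneg R} | f i (join (x, r') o)]].

End Auction.

Definition argmin d (T : porderType d) (S : Type) (A : set S) (g : S -> T)
    : set S :=
  [set x | A x /\ forall y, A y -> (g x <= g y)%O].

(* Main.v *)
(* Charge gwin to a winner and glose to a loser (a constant h does not affect
   incentives).  With the reported neighborhood fixed, winning costs exactly the
   critical bid more than losing, so by monotonicity a truthful value picks the
   better of the two outcomes; reporting the whole neighborhood minimizes both
   prices, so no deviation can offer a better price for either outcome. *)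
Require Import Defs.
From HB Require Import structures.
From mathcomp Require Import all_boot all_order all_algebra.
From mathcomp Require Import all_classical all_reals ereal.
From mathcomp Require Import lra.

Set Implicit Arguments.
Unset Strict Implicit.
Unset Printing Implicit Defensive.

Import Order.TTheory GRing.Theory Num.Theory.
Local Open Scope classical_set_scope.
Local Open Scope ring_scope.

(** Recovers the argument of [gwin] and [glose] from a full profile, on which payments are
    defined. *)
Definition opponents (R : realType) (N : finType) (i : N) (theta : profile R N)
    : others R i :=
  fun j => theta (val j).
Arguments opponents {R N} i theta.

Lemma join_self (R : realType) (N : finType) (i : N) (t : bidder_type R i)
    (o : others R i) : join t o i = t.
Proof.
rewrite /join; case: (eqVneq i i) => [e|ne]; last by case/eqP: (ne).
by rewrite (eq_axiomK e).
Qed.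

Lemma opponents_join (R : realType) (N : finType) (i : N)
    (t : bidder_type R i) (o : others R i) : opponents i (join t o) = o.
Proof.
apply: functional_extensionality_dep => -[j ne]; rewrite /opponents /join /=.
case: (eqVneq j i) => [e|ne']; first by case/eqP: (ne).
by rewrite (bool_irrelevance ne' ne).
Qed.

Section CriticalBid.
Context (R : realType) (N : finType) (f : allocation R N).
Context (i : N) (o : others R i) (r : nbhd i).

Lemma critical_bid_ge0 : (0 <= critical_bid f o r)%E.
Proof. by apply: le_ereal_inf_tmp => _ [x _ <-]; rewrite lee_fin. Qed.

Lemma critical_bid_le_win (v : {nonneg R}) :
  f i (join (v, r) o) -> (critical_bid f o r <= v%:num%:E)%E.
Proof. by move=> win; apply: ereal_inf_lbound; exists v. Qed.

(** By monotonicity no winning value lies below a losing one, so [v] is a lower bound of the winning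
    values. *)
Lemma critical_bid_ge_lose (v : {nonneg R}) : value_monotone f ->
  ~~ f i (join (v, r) o) -> (v%:num%:E <= critical_bid f o r)%E.
Proof.
move=> f_mono lose; apply: le_ereal_inf_tmp => _ [x xwin <-].
rewrite lee_fin leNgt; apply: contra lose => /ltW; exact: f_mono xwin.
Qed.

End CriticalBid.

(* The winning payments are extended reals, because
   [gwin i o r - glose i o r = critical_bid f o r] forces [gwin i o r = +oo] when
   bidder i never wins with report r; real-valued [gwin] is a special case. *)
Theorem corollary4p1 (R : realType) (N : finType) (f : allocation R N)
  (f_mono : value_monotone f)
  (pwin gwin : forall i : N, others R i -> nbhd i -> \bar R)
  (plose glose : forall i : N, others R i -> nbhd i -> R)
  (h : forall i : N, others R i -> R)
  (pwinE : forall (i : N) (o : others R i) (r' : nbhd i),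
    pwin i o r' = (gwin i o r' + (h i o)%:E)%E)
  (ploseE : forall (i : N) (o : others R i) (r' : nbhd i),
    plose i o r' = glose i o r' + h i o)
  (g_crit : forall (i : N) (o : others R i) (r : nbhd i),
    (gwin i o r - (glose i o r)%:E)%E = critical_bid f o r)
  (gwin_min : forall (i : N) (o : others R i) (r : nbhd i),
    argmin [set r' : nbhd i | r' \subset r] (gwin i o) r)
  (glose_min : forall (i : N) (o : others R i) (r : nbhd i),
    argmin [set r' : nbhd i | r' \subset r] (glose i o) r) :
  network_implementable f.
Proof.
(* [fine] is applied only when the bidder wins; the critical bid, hence [gwin], is then finite. *)
exists (fun i theta => if f i theta
  then fine (gwin i (opponents i theta) (theta i).2)
  else glose i (opponents i theta) (theta i).2).
move=> i [v r] [v' r'] o /= r'r.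
rewrite /utility !opponents_join !join_self /=.
have [_ /(_ _ r'r) gw_le] := gwin_min i o r.
have [_ /(_ _ r'r) gl_le] := glose_min i o r.
have gwinE s : gwin i o s = (critical_bid f o s + (glose i o s)%:E)%E.
  by rewrite -g_crit subeK.
(* A real upper bound excludes [+oo], nonnegativity excludes [-oo]. *)
have fin_crit s x : (critical_bid f o s <= x%:E)%E ->
    exists2 c : R, critical_bid f o s = c%:E & gwin i o s = (c + glose i o s)%:E.
  move=> le_x; have := critical_bid_ge0 f o s; move: le_x (gwinE s).
  by case: (critical_bid f o s) => [c| |] // _ -> _; exists c.
move: gw_le gl_le => /= gw_le gl_le.
case: (boolP (f i (join (v, r) o))) => [win|lose];
  case: (boolP (f i (join (v', r') o))) => [win'|lose'];
  rewrite ?mul1r ?mul0r.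
- have [c _ gE] := fin_crit _ _ (critical_bid_le_win win).
  have [c' _ gE'] := fin_crit _ _ (critical_bid_le_win win').
  by move: gw_le; rewrite gE gE' lee_fin /= => ?; lra.
- have [c cE ->] := fin_crit _ _ (critical_bid_le_win win).
  by move: (critical_bid_le_win win); rewrite cE lee_fin /= => ?; lra.
(* No winning bid with report [r] is at hand here; finiteness at [r] comes from
   [gwin i o r <= gwin i o r'], which bounds the critical bid by [gwin i o r' - glose i o r]. *)
- have [c' _ gE'] := fin_crit _ _ (critical_bid_le_win win').
  have [c cE gE] : exists2 c : R, critical_bid f o r = c%:E &
      gwin i o r = (c + glose i o r)%:E.
    apply: (fin_crit r (c' + glose i o r' - glose i o r)).
    by rewrite -g_crit EFinB -gE' leeB.
  move: gw_le (critical_bid_ge_lose f_mono lose).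
  by rewrite gE' gE cE !lee_fin /= => ? ?; lra.
- by lra.
Qed.
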